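(* Let $C$ be a nonempty convex subset of $X$, let $F\colon X\to Y\cup\{+\infty_Y\}$ be a proper $K$-convex mapping, and let $G\colon X\to Z\cup\{+\infty_Z\}$ be a proper $S$-convex mapping. Let $A:=C\cap G^{-1}(-S)$ and $E:=G(C\cap\operatorname{dom}F\cap\operatorname{dom}G)+S$. Assume that $A\cap\operatorname{dom}F\neq\emptyset$ and that at least one of the following conditions holds: $(c_1)$ there exists $\bar x\in C\cap\operatorname{dom}F$ such that $G(\bar x)\in-\operatorname{int}S$; $(c_2)$ $X,Z$ are Fréchet spaces, $C$ is closed, $y^*\circ F$ is lower semicontinuous for all $y^*\in Y^*$, $G$ is $S$-epi closed and $0_Z\in\operatorname{sqri}E$; $(c_3)$ $\dim\operatorname{lin}E<+\infty$ and $0_Z\in\operatorname{ri}E$. Then the following statements are equivalent: $(c)$ $\displaystyle\operatorname{epi}_K(F+I_A)^*=\bigcup_{T\in\mathcal{L}_+^w(S,K)}\Big[\bigcap_{v\in I_{-S}^*(T)}\big[\operatorname{epi}_K(F+I_C+T\circ G)^*+(0_{\mathcal{L}},v)\big]\Big].$ $(d)$ For any $y\in Y$ and any $L\in\mathcal{L}(X,Y)$, the following assertions $(b_1)$ and $(b_3)$ are equivalent: $(b_1)$ for all $x$: if $x\in C$ and $G(x)\in-S$, then $F(x)-L(x)+y\notin-\operatorname{int}K$; $(b_3)$ there exists $T\in\mathcal{L}_+^w(S,K)$ such that $F(x)+(T\circ G)(x)-L(x)+y\notin T(-S)-\operatorname{int}K$ for all $x\in C$.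
   Context: $X,Y,Z$ are (real) locally convex Hausdorff topological vector spaces with topological duals $X^*,Y^*,Z^*$; $K\subset Y$ is a closed, pointed, convex cone with $\operatorname{int}K\neq\emptyset$; $S\subset Z$ is a nonempty closed convex cone. Order and infinite elements: for $y_1,y_2\in Y$, $y_1<_K y_2$ means $y_1-y_2\in-\operatorname{int}K$. $Y^\bullet:=Y\cup\{-\infty_Y,+\infty_Y\}$, where $\pm\infty_Y\notin Y$ and $-\infty_Y<_K y<_K+\infty_Y$ for all $y\in Y$ (hence also $-\infty_Y<_K+\infty_Y$). Conventions: $-(+\infty_Y)=-\infty_Y$, $-(-\infty_Y)=+\infty_Y$, $(+\infty_Y)+y=y+(+\infty_Y)=+\infty_Y$ for $y\in Y\cup\{+\infty_Y\}$, $(-\infty_Y)+y=y+(-\infty_Y)=-\infty_Y$ for $y\in Y\cup\{-\infty_Y\}$. Analogous elements $\pm\infty_Z$ and conventions are used for $Z$ (ordered by $S$). Weak supremum: for $\emptyset\neq M\subset Y^\bullet$, $\operatorname{WSup}M$ is the set of $\bar v\in Y^\bullet$ such that $\bar v\not<_K v$ for all $v\in M$, and for every $\tilde v\in Y^\bullet$ with $\tilde v<_K\bar v$ there is $v\in M$ with $\tilde v<_K v$. Mappings: for $F\colon X\to Y^\bullet$, $\operatorname{dom}F=\{x\in X: F(x)\neq+\infty_Y\}$; $F$ is proper if $\operatorname{dom}F\neq\emptyset$ and $-\infty_Y\notin F(X)$; $\operatorname{epi}_KF=\{(x,y)\in X\times Y: y\in F(x)+K\}$; $F$ is $K$-convex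 if $\operatorname{epi}_KF$ is convex, and $K$-epi closed if it is closed. The same notions are used for $G$ with $(Z,S)$ in place of $(Y,K)$. For $y^*\in Y^*$, $(y^*\circ F)(x)=y^*(F(x))$ if $F(x)\in Y$ and $+\infty$ if $F(x)=+\infty_Y$. $\mathcal{L}(X,Y)$ is the space of continuous linear mappings $X\to Y$; $0_{\mathcal{L}}$ is its zero element. The conjugate of $F$ is the set-valued map $F^*(L)=\operatorname{WSup}\{L(x)-F(x):x\in X\}$, $L\in\mathcal{L}(X,Y)$, and $\operatorname{epi}_KF^*=\{(L,y)\in\mathcal{L}(X,Y)\times Y: y\in F^*(L)+K\}$. For a set $D$ in $X$ (or in $Z$), $I_D(x)=0_Y$ if $x\in D$ and $I_D(x)=+\infty_Y$ otherwise; in particular, for $-S\subset Z$ and $T\in\mathcal{L}(Z,Y)$, $I_{-S}^*(T)=\operatorname{WSup}T(-S)$. For $T\in\mathcal{L}(Z,Y)$, $(T\circ G)(x)=T(G(x))$ if $G(x)\in Z$ and $+\infty_Y$ if $G(x)=+\infty_Z$. $\mathcal{L}_+^w(S,K)=\{T\in\mathcal{L}(Z,Y): T(S)\cap(-\operatorname{int}K)=\emptyset\}$. For a convex set $U$: $\operatorname{lin}U$ is its linear hull, $\operatorname{ri}U$ its relative interior (interior relative to its affine hull), and $\operatorname{sqri}U$ its strong quasi-relative interior, i.e. the set of $u\in U$ such that the cone $\bigcup_{\lambda\ge 0}\lambda(U-u)$ is a closed linear subspace. *)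

(* Defs.v *)
(* Locally convex spaces are the [tvsType R] of MathComp-Analysis, over
   [R : realType].  A [tvsType] carries some uniformity compatible with its
   topology, not necessarily the translation-invariant one; nothing below
   refers to that uniformity. *)
From HB Require Import structures.
From mathcomp Require Import all_boot all_order all_algebra.
From mathcomp Require Import all_classical all_reals.
From mathcomp Require Import topology convex normedtype.

Set Implicit Arguments.
Unset Strict Implicit.
Unset Printing Implicit Defensive.

Import Order.TTheory GRing.Theory Num.Theory.
Import numFieldNormedType.Exports.

Local Open Scope classical_set_scope.
Local Open Scope ring_scope.

(** ** The space of continuous linear mappings *)

Section ContinuousLinear.
Context (R : realType) (X Y : tvsType R).

Definition clin_pred : {pred X -> Y} :=
  [pred f : X -> Y | `[< linear f /\ continuous f >]].

Lemma clin_predP (f : X -> Y) :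
  reflect (linear f /\ continuous f) (f \in clin_pred).
Proof. exact: asboolP. Qed.

Lemma clin_pred_zmod_closed : zmod_closed clin_pred.
Proof.
split=> [|f g /clin_predP[flin fcont] /clin_predP[glin gcont]]; apply/clin_predP.
  split=> [a x y|x]; first by rewrite /= scaler0 addr0.
  exact: cvg_cst.
split=> [a x y|x].
  by rewrite !fctE flin glin scalerBr opprD addrACA.
have sub_cont : continuous (fun p : Y * Y => p.1 - p.2).
  move=> p.
  apply: (@continuous_comp _ _ _ (fun q : Y * Y => (q.1, - q.2))
    (fun q : Y * Y => q.1 + q.2)); last exact: add_continuous.
  apply: cvg_pair; first exact: cvg_fst.
  by apply: continuous_comp; [exact: cvg_snd|exact: opp_continuous].
apply: (@continuous_comp _ _ _ (fun x => (f x, g x))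
  (fun p : Y * Y => p.1 - p.2)); last exact: sub_cont.
by apply: cvg_pair; [exact: fcont|exact: gcont].
Qed.

HB.instance Definition _ := GRing.isZmodClosed.Build (X -> Y) clin_pred
  clin_pred_zmod_closed.

Record clin := Clin { clin_fun :> X -> Y; _ : clin_fun \in clin_pred }.

HB.instance Definition _ := [isSub for clin_fun].
HB.instance Definition _ := [Choice of clin by <:].
HB.instance Definition _ := [SubChoice_isSubZmodule of clin by <:].

Lemma clin_linear (L : clin) : linear L.
Proof. by case: L => f /= /clin_predP[]. Qed.

Lemma clin_continuous (L : clin) : continuous L.
Proof. by case: L => f /= /clin_predP[]. Qed.

HB.instance Definition _ (L : clin) :=
  GRing.isLinear.Build R X Y *:%R L (clin_linear L).

End ContinuousLinear.

(** ** Sets in vector spaces *)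

Section Sets.
Context (R : realType).

Definition oppset (V : zmodType) (A : set V) : set V := [set - a | a in A].

Definition cone (V : lmodType R) (A : set V) : Prop :=
  forall (t : R) x, 0 <= t -> A x -> A (t *: x).

Definition pointed_cone (V : zmodType) (A : set V) : Prop :=
  A `&` oppset A = [set 0].

Definition linear_subspace (V : lmodType R) (M : set V) : Prop :=
  M 0 /\ forall (a : R) x y, M x -> M y -> M (a *: x + y).

Definition affine_set (V : lmodType R) (M : set V) : Prop :=
  forall (t : R) x y, M x -> M y -> M ((1 - t) *: x + t *: y).

Definition lin (V : lmodType R) (U : set V) : set V :=
  smallest (@linear_subspace V) U.

Definition aff (V : lmodType R) (U : set V) : set V :=
  smallest (@affine_set V) U.

Definition finite_dim (V : lmodType R) (M : set V) : Prop :=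
  exists (n : nat) (e : 'I_n -> V),
    M = [set \sum_(i < n) a i *: e i | a in [set: 'I_n -> R]].

(* [within (aff U) (nbhs u)] is the neighbourhood filter of [u] in the
   topology induced on the affine hull. *)
Definition ri (V : tvsType R) (U : set V) : set V :=
  [set u | U u /\ within (aff U) (nbhs u) U].

Definition sqri (V : tvsType R) (U : set V) : set V :=
  [set u | U u /\
    let W := \bigcup_(l in [set l : R | 0 <= l]) [set l *: (w - u) | w in U] in
    closed W /\ linear_subspace W].

(* Local convexity is part of [tvsType]. *)
Definition frechet (V : tvsType R) : Prop :=
  exists d : V -> V -> R,
    [/\ (forall x y, d x y = 0 <-> x = y),
        (forall x y, d x y = d y x),
        (forall x y z, d x z <= d x y + d y z),
        (forall x y z, d (x + z) (y + z) = d x y) &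
        (forall x (A : set V), nbhs x A <->
          exists2 e : R, 0 < e & forall y, d x y < e -> A y) /\
        (forall u : nat -> V,
          (forall e : R, 0 < e -> exists N : nat, forall m n : nat,
             (N <= m)%N -> (N <= n)%N -> d (u m) (u n) < e) ->
          exists l : V, u @ \oo --> l)].

End Sets.

(** ** Extended vector spaces and vector-valued conjugates *)

(* [Y] with its two infinite elements is [\bar Y], whose addition and
   opposite are those of [constructive_ereal] (they only need [Y] to be a
   [zmodType]).  The sum [+oo + -oo], which is left undefined in the usual
   conventions, is [-oo] there; it never arises for mappings that do not take
   the value [-oo]. *)
Section Extended.
Context (R : realType).
Local Open Scope ereal_scope.

Definition ltK (Y : tvsType R) (K : set Y) (v w : \bar Y) : Prop :=
  match v, w with
  | y1%:E, y2%:E => oppset K° (y1 - y2)%R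
  | -oo, _%:E | -oo, +oo | _%:E, +oo => True
  | _, _ => False
  end.

Definition WSup (Y : tvsType R) (K : set Y) (M : set (\bar Y)) : set (\bar Y) :=
  [set v | (forall m, M m -> ~ ltK K v m) /\
           (forall w, ltK K w v -> exists2 m, M m & ltK K w m)].

Definition dom (X Y : Type) (F : X -> \bar Y) : set X := [set x | F x <> +oo].

Definition proper_map (X Y : Type) (F : X -> \bar Y) : Prop :=
  dom F !=set0 /\ ~ range F -oo.

Definition epi (X Y : tvsType R) (K : set Y) (F : X -> \bar Y) : set (X * Y) :=
  [set p | exists2 k, K k & p.2%:E = F p.1 + k%:E].

Definition indicator (X : Type) (Y : zmodType) (D : set X) : X -> \bar Y :=
  fun x => if x \in D then 0 else +oo.

Definition conjugate (X Y : tvsType R) (K : set Y) (F : X -> \bar Y) :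
    clin X Y -> set (\bar Y) :=
  fun L => WSup K (range (fun x => (L x)%:E - F x)).

Definition epi_setvalued (X Y : tvsType R) (K : set Y)
    (H : clin X Y -> set (\bar Y)) : set (clin X Y * Y) :=
  [set p | exists v k, [/\ H p.1 v, K k & p.2%:E = v + k%:E]].

(* The translate of [P] by [(L0, v)]; as [v] ranges over a subset of [\bar Y],
   it is allowed to be infinite, in which case the translate has no element in
   [clin X Y * Y]. *)
Definition translate (X Y : tvsType R) (P : set (clin X Y * Y))
    (L0 : clin X Y) (v : \bar Y) : set (clin X Y * Y) :=
  [set p | exists q, [/\ P q, p.1 = (q.1 + L0)%R & p.2%:E = q.2%:E + v]].

Definition Lw_plus (Y Z : tvsType R) (S : set Z) (K : set Y) :
    set (clin Z Y) :=
  [set T | (T @` S) `&` oppset K° = set0].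

End Extended.

Arguments indicator {X} Y D.

(* Main.v *)
Require Import Defs.
From HB Require Import structures.
From mathcomp Require Import all_boot all_order all_algebra interval_inference.
From mathcomp Require Import all_classical all_reals.
From mathcomp Require Import topology convex normedtype.

Set Implicit Arguments.
Unset Strict Implicit.
Unset Printing Implicit Defensive.

Import Order.TTheory GRing.Theory Num.Theory.
Import numFieldNormedType.Exports.

Local Open Scope classical_set_scope.
Local Open Scope ring_scope.

(** The equivalence holds pair by pair.  For each [(L, y)], membership in the
    epigraph on the left of the set equality says that [F x - L x + y] avoids
    [- int K] on the feasible set, and membership on the right says that some
    weakly positive [T] is a multiplier for this system.  The equality of the two
    sets is then, extensionally, the equivalence of these two conditions for all
    [L] and [y].

    Both descriptions rest on one geometric fact, [WSup_on_line].  Let [e] be an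
    interior point of [K] and let [M] have a finite element and a weak upper bound.
    On any line in direction [e] the points strictly below some element of [M] form
    an open half-line whose endpoint belongs to [WSup M].  Two consequences follow.
    Moving down from a weak upper bound one reaches [WSup M], so [WSup M + K] is the
    set of weak upper bounds of [M] ([WSup_addP]); for the values [L x - H x] this
    describes the epigraph of a conjugate as the pairs [(L, y)] such that
    [H x - L x + y] never lies in [- int K] ([epi_conjugateP]).  Moving up from a
    point strictly below some element of [M] one reaches [WSup M] strictly later, so
    [WSup M - int K = M - int K] ([WSup_dominatedP]); for [M = T (- S)] this merges
    the conditions attached to all the translates by [v] in [WSup (T (- S))] into the
    single multiplier condition ([bigcap_translateP]). *)

(** * Interiors of convex cones *)

Section ConeInterior.
Context (R : realType) (Y : tvsType R) (K : set Y).

Lemma interior_ray (a d : Y) :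
  K° a -> exists2 eps : R, 0 < eps & K° (a + eps *: d).
Proof.
move=> Ka.
(* The regular module [R^o] makes [t *: d] an instance of the jointly
   continuous scaling. *)
have cont : (fun t : R^o => a + t *: d) @ (0 : R^o) --> a.
  rewrite -[X in _ --> X]addr0 -(scale0r d).
  apply: (@continuous2_cvg _ _ _ _ _ _ _ _ (@GRing.add Y)).
  - exact: (@add_continuous Y (a, 0 *: d)).
  - exact: cvg_cst.
  apply: (@continuous2_cvg _ _ _ _ _ _ _ _ (fun (t : R^o) (z : Y) => t *: z)).
  - exact: (@scale_continuous _ Y (0 : R^o, d)).
  - exact: cvg_id.
  - exact: cvg_cst.
have /cont : nbhs a K° by apply: open_nbhs_nbhs; split=> //; exact: open_interior.
move=> /nbhs_ballP[e /= e0 eK]; exists (e / 2); first by rewrite divr_gt0.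
apply: eK; rewrite -ball_normE /= sub0r normrN gtr0_norm ?divr_gt0//.
by rewrite gtr_pMr// invf_lt1// ltr1n.
Qed.

Context (K_convex : convex_set K) (K_cone : cone K).

Lemma cone_addr (a b : Y) : K a -> K b -> K (a + b).
Proof.
move=> Ka Kb.
(* [a + b] is the midpoint of [2 *: a] and [2 *: b]. *)
have K2 (x : Y) : K x -> K (2 *: x) by apply: K_cone.
have h0 : (0 : R) <= 2^-1 by rewrite invr_ge0.
have h1 : (2^-1 : R) <= 1 by rewrite invf_le1 ?ler1n.
have := K_convex (Itv01 h0 h1) (mem_set (K2 _ Ka)) (mem_set (K2 _ Kb)).
rewrite inE; congr K; rewrite /conv /= /unstable.onem.
have -> : 1 - 2^-1 = 2^-1 :> R by rewrite [X in X - _](splitr 1) mul1r addrK.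
by rewrite !scalerK.
Qed.

Lemma interior_addr (a b : Y) : K° a -> K b -> K° (a + b).
Proof.
move=> Ka Kb; rewrite addrC.
apply: filterS (nbhsB b Ka) => _ [z Kz <-].
exact: cone_addr.
Qed.

Lemma interior_scale (t : R) (a : Y) : 0 < t -> K° a -> K° (t *: a).
Proof.
move=> t0 Ka.
have cont : (fun z : Y => t^-1 *: z) @ (t *: a) --> a.
  rewrite -[X in _ --> X](scalerK (lt0r_neq0 t0)).
  apply: (@continuous2_cvg _ _ _ _ _ _ _ _ (fun (t : R^o) (z : Y) => t *: z)).
  - exact: (@scale_continuous _ Y (t^-1 : R^o, t *: a)).
  - exact: cvg_cst.
  - exact: cvg_id.
apply: (@filterS _ (nbhs (t *: a)) _ _ _ _ (cont _ Ka)) => z Kz.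
by rewrite -(scalerKV (lt0r_neq0 t0) z); apply: K_cone => //; exact: ltW.
Qed.

(** Since [e] is interior, [e + eps *: y] is still in the interior for some
    [eps > 0]; dividing by [eps] turns the smallness of the multiple of [y] into
    the largeness of the multiple of [e]. *)
Lemma interior_absorb (e y : Y) :
  K° e -> exists2 t : R, 0 < t & K° (t *: e + y).
Proof.
move=> /interior_ray-/(_ y)[eps eps0 Ke]; exists eps^-1; first by rewrite invr_gt0.
rewrite -[y](scalerK (lt0r_neq0 eps0)) -scalerDr.
by apply: interior_scale => //; rewrite invr_gt0.
Qed.

End ConeInterior.

(** * Weak suprema of bounded sets *)

Section WeakSupremum.
Context (R : realType) (Y : tvsType R) (K : set Y).

(** The set [M - int K] when [M] has no infinite element; the points outside of
    it are the weak upper bounds of [M]. *)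
Definition dominated (M : set (\bar Y)) (y : Y) : Prop :=
  exists2 m, M m & ltK K y%:E m.

Lemma ltK_fin (y w : Y) : ltK K y%:E w%:E <-> K° (w - y).
Proof.
rewrite /= /oppset /=; split=> [[k Kk kE]|Kwy].
  by rewrite -[w - y]opprB -kE opprK.
by exists (w - y) => //; rewrite opprB.
Qed.

Lemma dominated_WSup (M : set (\bar Y)) (y v : Y) :
  WSup K M v%:E -> K° (v - y) -> dominated M y.
Proof. by move=> [_ vM] vy; apply: vM; apply/ltK_fin. Qed.

(** [-oo] lies strictly below the finite element of [M], and [+oo] would force
    every point of the space to be dominated. *)
Lemma WSup_finite (M : set (\bar Y)) (m u : Y) (v : \bar Y) :
  M m%:E -> ~ dominated M u -> WSup K M v -> exists r, v = r%:E.
Proof.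
case: v => [r _ _ _|_ Mu [_ /(_ u%:E I)]//|Mm _ [/(_ _ Mm)/(_ I)]//].
by exists r.
Qed.

Context (K_convex : convex_set K) (K_cone : cone K).

Lemma dominated_sub (M : set (\bar Y)) (y w : Y) :
  K (w - y) -> dominated M w -> dominated M y.
Proof.
move=> Kwy [[m| |] Mm // wm]; last by exists +oo%E.
exists m%:E => //; apply/ltK_fin; rewrite -(subrKA w).
by apply: interior_addr => //; exact/ltK_fin.
Qed.

Lemma dominated_open (M : set (\bar Y)) (y e : Y) :
  dominated M y -> exists2 eps : R, 0 < eps & dominated M (y + eps *: e).
Proof.
move=> [[m| |] Mm // ym]; last by exists 1 => //; exists +oo%E.
have /ltK_fin/interior_ray-/(_ (- e))[eps eps0 Kme] := ym.
exists eps => //; exists m%:E => //; apply/ltK_fin.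
by rewrite opprD addrA -scalerN.
Qed.

(** The dominated points form an open set that is stable under subtracting [K],
    so its trace on a line in an interior direction is an open half-line; a finite
    element of [M] makes it nonempty and a weak upper bound makes it proper, since
    [int K] absorbs every vector.  Its endpoint is not dominated, but everything
    strictly below it is, so it is a weak supremum.  Everything else about [WSup]
    is read off from the position of a point with respect to this endpoint. *)
Lemma WSup_on_line (M : set (\bar Y)) (m u p e : Y) :
  M m%:E -> ~ dominated M u -> K° e ->
  exists2 s : R, WSup K M (p + s *: e)%:E &
    forall t : R, dominated M (p + t *: e) <-> t < s.
Proof.
move=> Mm Mu Ke.
have Ke' := interior_subset Ke.
pose B : set R := [set t | dominated M (p + t *: e)].
have B_sup : has_sup B.
  split.
    have [t t0 Kt] := interior_absorb K_cone (m - p) Ke.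
    exists (- t); exists m%:E => //; apply/ltK_fin.
    by rewrite scaleNr opprB addrCA.
  (* Beyond this [t] the line lies above the weak upper bound [u]. *)
  have [t t0 Kt] := interior_absorb K_cone (p - u) Ke.
  exists t => t' Bt'; rewrite leNgt; apply/negP => tt'; apply: Mu.
  apply: dominated_sub Bt'.
  have -> : p + t' *: e - u = (t' - t) *: e + (t *: e + (p - u)).
    by rewrite scalerBl subrKA addrA [t' *: e + p]addrC.
  apply: cone_addr => //; last exact: interior_subset.
  by apply: K_cone => //; rewrite subr_ge0 ltW.
have BE t : B t <-> t < sup B.
  split=> [Bt|]; last first.
    move=> /(sup_gt B_sup.1)[t' Bt' tt']; apply: dominated_sub Bt'.
    rewrite opprD addrACA subrr add0r -scalerBl.
    by apply: K_cone => //; rewrite subr_ge0 ltW.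
  have [eps eps0] := dominated_open e Bt.
  rewrite -addrA -scalerDl => /(sup_upper_bound B_sup); apply: lt_le_trans.
  by rewrite ltrDl.
exists (sup B) => //; split=> [n Mn vn|[w| |]//].
- have /BE : B (sup B) by exists n.
  by rewrite ltxx.
- move=> /ltK_fin/interior_ray-/(_ (- e))[eps eps0 Kw].
  have /BE : sup B - eps < sup B by rewrite ltrBlDr ltrDl.
  move=> Bs; rewrite -/(dominated M w).
  apply: dominated_sub Bs; apply: interior_subset.
  by rewrite scalerBl addrA [_ - w]addrAC -scalerN.
- by move=> _; exists m%:E.
Qed.

Context (K_int : K° !=set0).

(** This is [WSup M - int K = M - int K]: on the line through a dominated point
    [y] in an interior direction, the endpoint of the dominated half-line lies
    strictly beyond [y]. *)
Lemma WSup_dominatedP (M : set (\bar Y)) (m u y : Y) :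
  M m%:E -> ~ dominated M u ->
  (exists2 v, WSup K M v%:E & K° (v - y)) <-> dominated M y.
Proof.
move=> Mm Mu; split=> [[v]|My]; first exact: dominated_WSup.
have [e Ke] := K_int.
have [s Ms sE] := WSup_on_line y Mm Mu Ke.
exists (y + s *: e) => //; rewrite addrAC subrr add0r.
by apply: interior_scale => //; apply/sE; rewrite scale0r addr0.
Qed.

(** Descending from a weak upper bound [y] in an interior direction, one meets
    [WSup M] at the endpoint of the dominated half-line, which is reached at a
    nonpositive parameter because [y] itself is not dominated. *)
Lemma WSup_addP (M : set (\bar Y)) (m y : Y) :
  M m%:E ->
  (exists v k, [/\ WSup K M v, K k & y%:E = (v + k%:E)%E]) <-> ~ dominated M y.
Proof.
move=> Mm; split=> [[[v| |] [k [[vM _] Kk //= [->]]]] vkM|My].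
  have [n Mn vn] : dominated M v.
    by apply: dominated_sub vkM; rewrite addrAC subrr add0r.
  exact: vM vn.
have [e Ke] := K_int.
have [s Ms sE] := WSup_on_line y Mm My Ke.
exists (y + s *: e)%:E, (- s *: e); split=> //; last first.
  by have {1}-> : y = y + s *: e + - s *: e by rewrite scaleNr addrK.
apply: K_cone; last exact: interior_subset.
rewrite oppr_ge0 leNgt; apply/negP => /sE.
by rewrite scale0r addr0.
Qed.

(** * Epigraphs of conjugates *)

(** By [WSup_addP], membership in the epigraph means that [y] is a weak upper
    bound of the values [L x - H x]; infinite values of [H] give [-oo] there, which
    constrains nothing. *)
Lemma epi_conjugateP (X : tvsType R) (H : X -> \bar Y) (L : clin X Y) (y : Y) :
  proper_map H ->
  epi_setvalued K (conjugate K H) (L, y) <->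
  forall x, ~ (EFin @` oppset K°) (H x - (L x)%:E + y%:E)%E.
Proof.
move=> [[x0 domH] H_fin].
have Hx0 : exists h, H x0 = h%:E.
  case Hx: (H x0) => [h| |]; [by exists h|by []|].
  by exfalso; apply: H_fin; exists x0.
have [h hE] := Hx0.
rewrite /epi_setvalued /conjugate /= (@WSup_addP _ (L x0 - h)); last first.
  by exists x0 => //; rewrite hE.
have eqv x : ltK K y%:E ((L x)%:E - H x)%E <->
    (EFin @` oppset K°) (H x - (L x)%:E + y%:E)%E.
  case Hx: (H x) => [r| |] /=.
  - have -> : (y - (L x - r) = r - L x + y) by rewrite opprB addrC.
    by split=> [yr|[z] yz [<-]//]; exists (r - L x + y).
  - by split=> // -[].
  - by exfalso; apply: H_fin; exists x.
split=> [nM x /eqv Mx|nM [_ [x _ <-] /eqv]]; last exact: nM.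
by apply: nM; exists ((L x)%:E - H x)%E => //; exists x.
Qed.

End WeakSupremum.

(** * Translates of epigraphs by the conjugate of an indicator *)

Section ConjugateIndicator.
Context (R : realType) (X Y Z : tvsType R) (K : set Y) (S : set Z).

Lemma dominated_indicator (T : clin Z Y) (D : set Z) (y : Y) :
  dominated K (range (fun z => (T z)%:E - indicator Y D z)%E) y <->
  exists2 t, (T @` D) t & K° (t - y).
Proof.
split=> [[_ [z _ <-]]|[_ [z Dz <-] Ky]]; last first.
  exists (T z)%:E; last exact/ltK_fin.
  exists z => //; rewrite /indicator mem_set//.
  by have {2}-> : T z = T z - 0 by rewrite subr0.
rewrite /indicator; case: ifPn => [/set_mem Dz|_ []].
have -> : ((T z)%:E - 0 = (T z)%:E)%E by rewrite -[in RHS](subr0 (T z)).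
by move=> /ltK_fin Ky; exists (T z) => //; exists z.
Qed.

Lemma translate0P (P : set (clin X Y * Y)) (L : clin X Y) (y r : Y) :
  translate P 0 r%:E (L, y) <-> P (L, y - r).
Proof.
split=> [[[L' y'] [/= Pq -> [->]]]|Py].
  by rewrite addr0 addrK.
exists (L, y - r); split=> //=; first by rewrite addr0.
by have {1}-> : y = y - r + r by rewrite subrK.
Qed.

Context (K_convex : convex_set K) (K_cone : cone K) (K_int : K° !=set0).
Context (S_nonempty : S !=set0) (S_cone : cone S).

(** For [T] weakly positive, [0] is a weak upper bound of [T (- S)], which also
    contains [0]; hence [WSup (T (- S))] consists of finite elements.  Membership
    of [(L, y)] in the translate by [v] says that no [H x - L x + y] lies in
    [v - int K], and the union of these sets over [v] in [WSup (T (- S))] is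
    [T (- S) - int K] by [WSup_dominatedP]. *)
Lemma bigcap_translateP (H : X -> \bar Y) (T : clin Z Y) (L : clin X Y)
    (y : Y) :
  proper_map H -> Lw_plus S K T ->
  (\bigcap_(v in conjugate K (indicator Y (oppset S)) T)
     translate (epi_setvalued K (conjugate K H)) 0 v) (L, y) <->
  forall x, ~ (EFin @` [set t - k | t in T @` oppset S & k in K°])
                (H x - (L x)%:E + y%:E)%E.
Proof.
move=> H_proper T_pos.
pose M := range (fun z => (T z)%:E - indicator Y (oppset S) z)%E.
have S0 : oppset S 0.
  have [s Ss] := S_nonempty; exists 0; last by rewrite oppr0.
  by rewrite -(scale0r s); apply: S_cone.
have M0 : M (0 : Y)%:E.
  have T0 : T 0 - 0 = 0 by rewrite raddf0 subr0.
  by exists 0 => //; rewrite /indicator mem_set//; exact: (congr1 (@EFin Y) T0).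
have M_bd : ~ dominated K M 0.
  move=> /dominated_indicator[_ [_ [s Ss <-] <-]]; rewrite subr0 raddfN => Ks.
  have : (T @` S `&` oppset K°) (T s).
    by split; [exists s|exists (- T s); rewrite ?opprK].
  by rewrite T_pos.
have shift (x : X) (h r : Y) : H x = h%:E ->
    (EFin @` oppset K°) (H x - (L x)%:E + (y - r)%:E)%E <->
    K° (r - (h - L x + y)).
  move=> ->; have -> : (h%:E - (L x)%:E + (y - r)%:E)%E = (h - L x + y - r)%:E.
    exact: (congr1 (@EFin Y) (addrA _ _ _)).
  split=> [[_ [k Kk <-] [/(congr1 -%R)]]|Kr]; first by rewrite opprK opprB => <-.
  by exists (h - L x + y - r) => //; exists (r - (h - L x + y)) => //; rewrite opprB.
have member (x : X) (h : Y) : H x = h%:E ->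
    (EFin @` [set t - k | t in T @` oppset S & k in K°])
      (H x - (L x)%:E + y%:E)%E <-> dominated K M (h - L x + y).
  move=> ->; split=> [[_ [t Tt [k Kk <-]] [tk]]|/dominated_indicator[t Tt Kt]].
    apply/dominated_indicator; exists t => //.
    by rewrite -tk opprB addrCA subrr addr0.
  exists (h - L x + y) => //; exists t => //; exists (t - (h - L x + y)) => //.
  by rewrite opprB addrCA subrr addr0.
split=> [cap x|nT v vM].
  case Hx : (H x) => [h| |]; [|by case|by case].
  rewrite -Hx => /(member _ _ Hx).
  move=> /(WSup_dominatedP K_convex K_cone K_int _ M0 M_bd)[r rM Kr].
  have /translate0P := cap _ rM.
  move=> /(epi_conjugateP K_convex K_cone K_int _ _ H_proper)/(_ x); apply.
  exact/(shift _ _ _ Hx).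
have [r rE] := WSup_finite M0 M_bd vM; rewrite rE in vM *.
apply/translate0P/(epi_conjugateP K_convex K_cone K_int _ _ H_proper) => x.
case Hx : (H x) => [h| |]; [|by case|by case].
rewrite -Hx => /(shift _ _ _ Hx) Kr; apply: (nT x); apply/(member _ _ Hx).
by apply/(WSup_dominatedP K_convex K_cone K_int _ M0 M_bd); exists r.
Qed.

End ConjugateIndicator.

Theorem theorem4p4 (R : realType) (X Y Z : tvsType R)
  (hX : hausdorff_space X) (hY : hausdorff_space Y) (hZ : hausdorff_space Z)
  (K : set Y) (K_closed : closed K) (K_pointed : pointed_cone K)
  (K_convex : convex_set K) (K_cone : cone K) (K_int : K° !=set0)
  (S : set Z) (S_nonempty : S !=set0) (S_closed : closed S)
  (S_convex : convex_set S) (S_cone : cone S)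
  (C : set X) (C_nonempty : C !=set0) (C_convex : convex_set C)
  (F : X -> \bar Y) (F_proper : proper_map F) (F_convex : convex_set (epi K F))
  (G : X -> \bar Z) (G_proper : proper_map G) (G_convex : convex_set (epi S G)) :
  let A : set X := C `&` G @^-1` (EFin @` oppset S) in
  let E : set Z := [set z | exists2 x, (C `&` dom F `&` dom G) x &
                            exists2 s, S s & z%:E = (G x + s%:E)%E] in
  A `&` dom F !=set0 ->
  [\/ (* c1 *)
      exists2 x, (C `&` dom F) x & (EFin @` oppset S°) (G x),
      (* c2 *)
      [/\ frechet X /\ frechet Z,
          closed C,
          (forall ystar : clin Y R^o,
            lower_semicontinuous (fun x => er_map ystar (F x) : \bar R)),
          closed (epi S G) &
          sqri E 0]
    | (* c3 *)
      finite_dim (lin E) /\ ri E 0] ->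
  (* c *)
  epi_setvalued K (conjugate K (F \+ indicator Y A)%E) =
    \bigcup_(T in Lw_plus S K)
      \bigcap_(v in conjugate K (indicator Y (oppset S)) T)
        translate
          (epi_setvalued K
            (conjugate K (fun x => F x + indicator Y C x + er_map T (G x))%E))
          0 v
  <->
  (* d *)
  (forall (y : Y) (L : clin X Y),
    (forall x, C x -> (EFin @` oppset S) (G x) ->
      ~ (EFin @` oppset K°) (F x - (L x)%:E + y%:E)%E)
    <->
    (exists2 T : clin Z Y, Lw_plus S K T &
      forall x, C x ->
        ~ (EFin @` [set t - k | t in T @` oppset S & k in K°])
            (F x + er_map T (G x) - (L x)%:E + y%:E)%E)).
Proof.
move=> A E [x0 [[Cx0 Gx0] domF0]] _.
(* With no value [-oo], the undefined sum [+oo + -oo] never occurs. *)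
have [_ F_fin] := F_proper; have [_ G_fin] := G_proper.
have addoo (y : \bar Y) : y <> -oo%E -> (y + +oo = +oo)%E by case: y.
have Foo x : F x <> -oo%E by move=> Fx; apply: F_fin; exists x.
have Goo (T : clin Z Y) x : er_map T (G x) <> -oo%E.
  by case Gx: (G x) => [z| |] //= _; apply: G_fin; exists x.
have addr0E (y : \bar Y) : (y + (0 : Y)%:E = y)%E.
  by case: y => // y; exact: (congr1 (@EFin Y) (addr0 y)).
have FA_in x : A x -> (F \+ indicator Y A)%E x = F x.
  by move=> Ax; rewrite /= /indicator mem_set// addr0E.
have FA_out x : ~ A x -> (F \+ indicator Y A)%E x = +oo%E.
  by move=> Ax; rewrite /= /indicator memNset// addoo.
have FA_proper : proper_map (F \+ indicator Y A)%E.
  split; first by exists x0; rewrite /dom /= -/((F \+ indicator Y A)%E x0) FA_in.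
  move=> [x _]; have [Ax|Ax] := pselect (A x); last by rewrite FA_out.
  by rewrite FA_in//; exact: Foo.
have epiA (L : clin X Y) y :
    epi_setvalued K (conjugate K (F \+ indicator Y A)%E) (L, y) <->
    forall x, C x -> (EFin @` oppset S) (G x) ->
      ~ (EFin @` oppset K°) (F x - (L x)%:E + y%:E)%E.
  rewrite epi_conjugateP//; split=> [h x Cx Gx|h x].
    by rewrite -FA_in//; exact: h.
  have [[Cx Gx]|Ax] := pselect (A x); last by rewrite FA_out// => -[].
  by rewrite FA_in//; exact: h.
pose H (T : clin Z Y) x := (F x + indicator Y C x + er_map T (G x))%E.
have H_in T x : C x -> H T x = (F x + er_map T (G x))%E.
  by move=> Cx; rewrite /H /indicator mem_set// addr0E.
have H_out T x : ~ C x -> H T x = +oo%E.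
  move=> Cx; rewrite /H /indicator memNset// addoo//.
  by case: (er_map T (G x)) (Goo T x).
have H_proper T : proper_map (H T).
  split.
    exists x0; rewrite /dom /= H_in//; case: Gx0 => z _ <-.
    by move: domF0; rewrite /dom /=; case: (F x0).
  move=> [x _]; have [Cx|Cx] := pselect (C x); last by rewrite H_out.
  rewrite H_in//; case: (F x) (Foo x) => // [f|] _;
    by case: (er_map T (G x)) (Goo T x).
have capP T (T_pos : Lw_plus S K T) L y :=
  bigcap_translateP K_convex K_cone K_int S_nonempty S_cone L y (H_proper T) T_pos.
have capH (L : clin X Y) y :
    (\bigcup_(T in Lw_plus S K)
      \bigcap_(v in conjugate K (indicator Y (oppset S)) T)
        translate (epi_setvalued K (conjugate K (H T))) 0 v) (L, y) <->
    exists2 T : clin Z Y, Lw_plus S K T &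
      forall x, C x ->
        ~ (EFin @` [set t - k | t in T @` oppset S & k in K°])
            (F x + er_map T (G x) - (L x)%:E + y%:E)%E.
  split=> -[T T_pos hT]; exists T => //.
    move=> x Cx; rewrite -H_in//.
    exact: (capP T T_pos L y).1.
  apply: (capP T T_pos L y).2 => x.
  have [Cx|Cx] := pselect (C x); last by rewrite H_out// => -[].
  by rewrite H_in//; exact: hT.
split=> [eqC y L|eqD]; first by rewrite -epiA -capH eqC.
by apply/seteqP; split=> -[L y] /=; [move/epiA/eqD/capH|move/capH/eqD/epiA].
Qed.
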